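(* Let $u:A\rightarrow B$ be a PSI-morphism. Then: (i) The spectral map $\alpha:\mathrm{Spec}(B)\rightarrow \mathrm{Spec}(A)$ is injective. (ii) If $P\in \mathrm{Im}(\alpha)$, then $$\alpha^{-1}(P)=\{b\in B \mid u(s)b\in PB \text{ for some } s\in A-P\}:=Q$$ and $k_A(P)\otimes_A B = k_B(Q)$. (iii) If $M\in \mathrm{Max}(A)$, then $MB\in \mathrm{Max}(B)$ or $MB=B$. (iv) If $A$ is a field, then so is $B$.
   Context: All rings are commutative and unitary, and ring morphisms are unitary. For a ring morphism $u:A\to B$, a proper ideal $I$ of $B$ is called $A$-prime if $u(a)b\in I$ with $a\in A$ and $b\in B$ implies that $u(a)\in I$ or $b\in I$. The morphism $u$ is a PSI-morphism if every $A$-prime ideal of $B$ is a prime ideal of $B$. The spectral map $\alpha$ sends a prime ideal $Q$ of $B$ to $u^{-1}(Q)$; in (ii), $\alpha^{-1}(P)$ denotes the unique prime ideal of $B$ lying over $P$. For an ideal $P$ of $A$, $PB$ denotes the ideal $u(P)B$ of $B$. $\mathrm{Max}$ denotes the set of maximal ideals. For a prime ideal $P$ of $A$, $k_A(P)=A_P/PA_P$ is the residue field of $A$ at $P$ (similarly for $B$). The equality $k_A(P)\otimes_A B = k_B(Q)$ means that the canonical map $k_A(P)\otimes_A B\to k_B(Q)$ is an isomorphism. *)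

(* Defs.v *)
From HB Require Import structures.
From mathcomp Require Import all_boot all_algebra.
From mathcomp Require Import ring boolp classical_sets.

Set Implicit Arguments.
Unset Strict Implicit.
Unset Printing Implicit Defensive.

Import GRing.Theory.
Local Open Scope ring_scope.
Local Open Scope quotient_scope.
Local Open Scope classical_set_scope.

(* Rings are [comNzRingType]s, so that 1 != 0 in them.  In ring_quotient,
   [idealr_closed I] says that I is a proper ideal, and the structure
   [prime_idealr R] bundles the prime ideals of R: it plays the role of
   Spec R.  Tensor products may be zero rings, hence are [comPzRingType]s. *)

Section Ideals.
Variable R : comNzRingType.

(* Possibly improper ideals. *)
Definition is_ideal (I : set R) : Prop :=
  I 0 /\ forall a x y, I x -> I y -> I (a * x + y).

Definition generated_ideal (X : set R) : set R := smallest is_ideal X.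

Definition prime_ideal (I : {pred R}) : Prop :=
  idealr_closed I /\ prime_idealr_closed I.

Definition maximal_ideal (I : {pred R}) : Prop :=
  idealr_closed I /\
  forall J : {pred R}, idealr_closed J -> {subset I <= J} -> J =i I.

Definition field_ring : Prop := forall x : R, x != 0 -> exists y, x * y = 1.

Lemma prime_idealr_eq (P Q : prime_idealr R) : (P : {pred R}) =i Q -> P = Q.
Proof.
case: P Q => [P cP] [Q cQ] /= PQ.
have {}PQ : P = Q by apply/funext => x; exact: PQ.
case: Q / PQ in cQ *; congr PrimeIdealr.Pack.
case: cP cQ => [[p1] [p2] [p3] [p4]] [[q1] [q2] [q3] [q4]].
by congr PrimeIdealr.Class; congr (_ _); exact: Prop_irrelevance.
Qed.

End Ideals.

Section PSI.
Variables (A B : comNzRingType) (u : {rmorphism A -> B}).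

Definition A_prime_ideal (I : {pred B}) : Prop :=
  idealr_closed I /\
  forall (a : A) (b : B), u a * b \in I -> u a \in I \/ b \in I.

Definition PSI_morphism : Prop :=
  forall I : {pred B}, A_prime_ideal I -> prime_ideal I.

(* The ideal IB. *)
Definition extended_ideal (I : {pred A}) : {pred B} :=
  fun b => `[< generated_ideal (u @` [set` I]) b >].

Definition contracted_ideal (Q : prime_idealr B) : {pred A} :=
  fun a => u a \in Q.

Section Contraction.
Variable Q : prime_idealr B.

Lemma contracted_idealE a : (a \in contracted_ideal Q) = (u a \in Q).
Proof. by []. Qed.

Lemma contracted_ideal_closed : idealr_closed (contracted_ideal Q).
Proof.
split; rewrite ?contracted_idealE.
- by rewrite rmorph0 rpred0.
- by rewrite rmorph1 idealr1.
- move=> a x y; rewrite !contracted_idealE rmorphD rmorphM => xQ yQ.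
  by rewrite rpredD // idealMr.
Qed.
HB.instance Definition _ :=
  isIdealr.Build A (contracted_ideal Q) contracted_ideal_closed.

Lemma contracted_ideal_prime : prime_idealr_closed (contracted_ideal Q).
Proof.
move=> x y; rewrite !contracted_idealE rmorphM.
by rewrite prime_idealrM.
Qed.
HB.instance Definition _ :=
  isPrimeIdealrClosed.Build A (contracted_ideal Q) contracted_ideal_prime.
End Contraction.

Definition spectral_map (Q : prime_idealr B) : prime_idealr A :=
  contracted_ideal Q.

End PSI.

Section Localization.
Variables (R : comNzRingType) (P : prime_idealr R).

Definition denominator := {s : R | s \notin P}.
Definition den (s : denominator) : R := val s.

Lemma denP s : den s \notin P. Proof. exact: (valP s). Qed.

Lemma denominator1_subproof : 1 \notin P.
Proof. by rewrite idealr1. Qed.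
Definition denominator1 : denominator := Sub 1 denominator1_subproof.

Lemma denominatorM_subproof s t : den s * den t \notin P.
Proof. by rewrite prime_idealrM negb_or !denP. Qed.
Definition denominatorM (s t : denominator) : denominator :=
  Sub (den s * den t) (denominatorM_subproof s t).

Lemma den1 : den denominator1 = 1. Proof. by []. Qed.
Lemma denM s t : den (denominatorM s t) = den s * den t. Proof. by []. Qed.

Definition frac_equiv (x y : R * denominator) : bool :=
  `[< exists v : denominator, den v * (x.1 * den y.2 - y.1 * den x.2) = 0 >].

Lemma frac_equivP x y :
  reflect (exists v : denominator, den v * (x.1 * den y.2) = den v * (y.1 * den x.2))
          (frac_equiv x y).
Proof.
apply: (iffP (asboolP _)) => -[v]; [move=> e | move=> e]; exists v.
  by apply/eqP; rewrite -subr_eq0 -mulrBr e.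
by rewrite mulrBr e subrr.
Qed.

Lemma frac_equiv_is_equiv : equiv_class_of frac_equiv.
Proof.
split=> [x|x y|y x z].
- by apply/frac_equivP; exists denominator1.
- by apply/frac_equivP/frac_equivP => -[v e]; exists v.
move=> /frac_equivP[v e] /frac_equivP[w f]; apply/frac_equivP.
exists (denominatorM (denominatorM v w) y.2); rewrite !denM.
transitivity (den w * den z.2 * (den v * (x.1 * den y.2))).
  ring.
rewrite e; transitivity (den v * den x.2 * (den w * (y.1 * den z.2))).
  ring.
rewrite f; ring.
Qed.

Canonical frac_equiv_equiv := EquivRelPack frac_equiv_is_equiv.
Canonical frac_equiv_encModRel := defaultEncModRel frac_equiv.

Definition localization := {eq_quot frac_equiv}.
HB.instance Definition _ : EqQuotient _ frac_equiv localization :=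
  EqQuotient.on localization.
HB.instance Definition _ := Choice.on localization.

Definition frac (a : R) (s : denominator) : localization := \pi_localization (a, s).

Lemma fracP a s b t :
  frac a s = frac b t <->
  exists v : denominator, den v * (a * den t) = den v * (b * den s).
Proof.
split=> [/eqP|e]; first by rewrite piE => /frac_equivP.
by apply/eqP; rewrite piE; apply/frac_equivP.
Qed.

Lemma frac_ind (K : localization -> Prop) :
  (forall a s, K (frac a s)) -> forall x, K x.
Proof. by move=> Kf; elim/quotW => -[a s]; exact: Kf. Qed.

Definition localization_add (x y : localization) : localization :=
  let: (a, s) := repr x in let: (b, t) := repr y in
  frac (a * den t + b * den s) (denominatorM s t).
Definition localization_opp (x : localization) : localization :=
  let: (a, s) := repr x in frac (- a) s.
Definition localization_mul (x y : localization) : localization :=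
  let: (a, s) := repr x in let: (b, t) := repr y in
  frac (a * b) (denominatorM s t).

Lemma repr_frac a s : exists b t, repr (frac a s) = (b, t) /\
  exists v : denominator, den v * (a * den t) = den v * (b * den s).
Proof.
case E: (repr (frac a s)) => [b t]; exists b, t; split=> //.
by apply/fracP; rewrite /frac -E reprK.
Qed.

Lemma localization_addE a s b t :
  localization_add (frac a s) (frac b t) =
  frac (a * den t + b * den s) (denominatorM s t).
Proof.
rewrite /localization_add.
have [a' [s' [-> [v e]]]] := repr_frac a s.
have [b' [t' [-> [w f]]]] := repr_frac b t.
apply/fracP; exists (denominatorM v w); rewrite !denM.
transitivity (den w * den t * den t' * (den v * (a' * den s)) +
              den v * den s * den s' * (den w * (b' * den t))); first by ring.
rewrite -e -f; ring.
Qed.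

Lemma localization_oppE a s : localization_opp (frac a s) = frac (- a) s.
Proof.
rewrite /localization_opp; have [a' [s' [-> [v e]]]] := repr_frac a s.
by apply/fracP; exists v; rewrite !mulNr !mulrN e.
Qed.

Lemma localization_mulE a s b t :
  localization_mul (frac a s) (frac b t) = frac (a * b) (denominatorM s t).
Proof.
rewrite /localization_mul.
have [a' [s' [-> [v e]]]] := repr_frac a s.
have [b' [t' [-> [w f]]]] := repr_frac b t.
apply/fracP; exists (denominatorM v w); rewrite !denM.
transitivity ((den v * (a' * den s)) * (den w * (b' * den t))); first by ring.
rewrite -e -f; ring.
Qed.

Let locE := (localization_addE, localization_oppE, localization_mulE).

Ltac frac_ring := apply/fracP; exists denominator1; rewrite ?denM ?den1; ring.

Fact localization_addA : associative localization_add.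
Proof.
elim/frac_ind=> a s; elim/frac_ind=> b t; elim/frac_ind=> c r.
by rewrite !locE; frac_ring.
Qed.
Fact localization_addC : commutative localization_add.
Proof.
elim/frac_ind=> a s; elim/frac_ind=> b t; rewrite !locE; frac_ring.
Qed.
Fact localization_add0 : left_id (frac 0 denominator1) localization_add.
Proof. elim/frac_ind=> a s; rewrite !locE; frac_ring. Qed.
Fact localization_addN :
  left_inverse (frac 0 denominator1) localization_opp localization_add.
Proof. elim/frac_ind=> a s; rewrite !locE; frac_ring. Qed.
HB.instance Definition _ := GRing.isZmodule.Build localization
  localization_addA localization_addC localization_add0 localization_addN.

Fact localization_mulA : associative localization_mul.
Proof.
elim/frac_ind=> a s; elim/frac_ind=> b t; elim/frac_ind=> c r.
by rewrite !locE; frac_ring.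
Qed.
Fact localization_mulC : commutative localization_mul.
Proof.
elim/frac_ind=> a s; elim/frac_ind=> b t; rewrite !locE; frac_ring.
Qed.
Fact localization_mul1 : left_id (frac 1 denominator1) localization_mul.
Proof. elim/frac_ind=> a s; rewrite !locE; frac_ring. Qed.
Fact localization_mulDl : left_distributive localization_mul +%R.
Proof.
elim/frac_ind=> a s; elim/frac_ind=> b t; elim/frac_ind=> c r.
rewrite /GRing.add /= !locE; frac_ring.
Qed.
Fact localization_nonzero1 : frac 1 denominator1 != 0.
Proof.
apply/eqP => /fracP[v]; rewrite den1 !mulr1 mulr0 => v0.
by have := denP v; rewrite v0 rpred0.
Qed.
HB.instance Definition _ := GRing.Zmodule_isComNzRing.Build localization
  localization_mulA localization_mulC localization_mul1 localization_mulDl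
  localization_nonzero1.

Lemma frac_add a s b t :
  frac a s + frac b t = frac (a * den t + b * den s) (denominatorM s t).
Proof. exact: localization_addE. Qed.
Lemma frac_opp a s : - frac a s = frac (- a) s.
Proof. exact: localization_oppE. Qed.
Lemma frac_mul a s b t :
  frac a s * frac b t = frac (a * b) (denominatorM s t).
Proof. exact: localization_mulE. Qed.
Lemma frac0 : 0 = frac 0 denominator1. Proof. by []. Qed.
Lemma frac1 : 1 = frac 1 denominator1. Proof. by []. Qed.

Definition to_localization (a : R) : localization := frac a denominator1.

Fact to_localization_zmod : zmod_morphism to_localization.
Proof. by move=> a b; rewrite /to_localization frac_opp frac_add; frac_ring. Qed.
Fact to_localization_monoid : monoid_morphism to_localization.
Proof.
by split=> [//|a b]; rewrite /to_localization frac_mul; frac_ring.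
Qed.
HB.instance Definition _ :=
  GRing.isZmodMorphism.Build R localization to_localization to_localization_zmod.
HB.instance Definition _ :=
  GRing.isMonoidMorphism.Build R localization to_localization
    to_localization_monoid.

(* The maximal ideal P R_P of R_P. *)
Definition local_ideal : {pred localization} := extended_ideal to_localization P.

Lemma local_ideal_sub x : x \in local_ideal ->
  exists a s, a \in P /\ x = frac a s.
Proof.
move=> /asboolP; apply: (smallest_sub
  (X := [set y | exists a s, a \in P /\ y = frac a s])).
- split=> [|c0 y z [a [s [aP ->]]] [b [t [bP ->]]]] /=.
    by exists 0, denominator1; rewrite rpred0.
  elim/frac_ind: c0 => [c r].
  exists (c * a * den t + b * (den r * den s)).
  exists (denominatorM (denominatorM r s) t); split.
    by rewrite rpredD ?[_ * a * _]mulrC ?[b * _]mulrC ?idealMr.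
  by rewrite frac_mul frac_add.
- by move=> _ [a /= aP <-]; exists a, denominator1.
Qed.

Lemma local_ideal_closed : idealr_closed local_ideal.
Proof.
split.
- by apply/asboolP => I [[]].
- apply/negP => /local_ideal_sub[a [s [aP]]] /fracP[v] /=.
  rewrite mul1r mulr1 => e.
  have := denominatorM_subproof v s; rewrite e idealMr //.
- move=> a x y /asboolP xI /asboolP yI; apply/asboolP => I II.
  by case: (II) => -[_ I1] _; apply: I1; [exact: xI | exact: yI].
Qed.
HB.instance Definition _ := isIdealr.Build localization local_ideal
  local_ideal_closed.

Definition residue_field := {ideal_quot local_ideal}.
HB.instance Definition _ := GRing.ComNzRing.on residue_field.

Lemma residue_fieldP x y : x - y \in local_ideal <->
  \pi_residue_field x = \pi_residue_field y.
Proof.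
have E := @Quotient.idealrBE _ local_ideal x y.
by split=> [xy|/eqP xy]; [apply/eqP; rewrite -E | rewrite E].
Qed.

Definition to_residue_field (a : R) : residue_field :=
  \pi_residue_field (to_localization a).

Fact to_residue_field_zmod : zmod_morphism to_residue_field.
Proof. by move=> a b; rewrite /to_residue_field !rmorphB. Qed.
Fact to_residue_field_monoid : monoid_morphism to_residue_field.
Proof.
by split=> [|a b]; rewrite /to_residue_field ?rmorph1 ?rmorphM.
Qed.
HB.instance Definition _ :=
  GRing.isZmodMorphism.Build R residue_field to_residue_field
    to_residue_field_zmod.
HB.instance Definition _ :=
  GRing.isMonoidMorphism.Build R residue_field to_residue_field
    to_residue_field_monoid.

End Localization.

Arguments denominator1 {R} P.
Arguments to_localization {R} P a.
Arguments local_ideal {R} P _.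
Arguments to_residue_field {R} P a.

Section ResidueMap.
Variables (A B : comNzRingType) (u : {rmorphism A -> B}).
Variables (P : prime_idealr A) (Q : prime_idealr B).
Hypothesis uQP : spectral_map u Q = P.

Lemma mem_spectral_map a : (u a \in Q) = (a \in P).
Proof. by rewrite -uQP. Qed.

Lemma map_denominator_subproof (s : denominator P) : u (den s) \notin Q.
Proof. by rewrite mem_spectral_map denP. Qed.
Definition map_denominator (s : denominator P) : denominator Q :=
  Sub (u (den s)) (map_denominator_subproof s).

Lemma den_map s : den (map_denominator s) = u (den s).
Proof. by []. Qed.

Definition localization_map (x : localization P) : localization Q :=
  let: (a, s) := repr x in frac (u a) (map_denominator s).

Lemma localization_mapE a s :
  localization_map (frac a s) = frac (u a) (map_denominator s).
Proof.
rewrite /localization_map; have [b [t [-> [v e]]]] := repr_frac a s.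
apply/fracP; exists (map_denominator v); rewrite !den_map -!rmorphM.
by congr (u _); rewrite e.
Qed.

Fact localization_map_zmod : zmod_morphism localization_map.
Proof.
elim/frac_ind=> a s; elim/frac_ind=> b t.
rewrite frac_opp frac_add !localization_mapE frac_opp frac_add.
apply/fracP; exists (denominator1 Q).
by rewrite !(denM, den_map) rmorphD !rmorphM rmorphN.
Qed.
Fact localization_map_monoid : monoid_morphism localization_map.
Proof.
split=> [|].
  rewrite !frac1 localization_mapE; apply/fracP; exists (denominator1 Q).
  by rewrite den_map !den1 !rmorph1.
elim/frac_ind=> a s; elim/frac_ind=> b t.
rewrite frac_mul !localization_mapE frac_mul.
apply/fracP; exists (denominator1 Q).
by rewrite !(denM, den_map) !rmorphM.
Qed.
HB.instance Definition _ :=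
  GRing.isZmodMorphism.Build (localization P) (localization Q)
    localization_map localization_map_zmod.
HB.instance Definition _ :=
  GRing.isMonoidMorphism.Build (localization P) (localization Q)
    localization_map localization_map_monoid.

Lemma localization_map_ideal x :
  x \in local_ideal P -> localization_map x \in local_ideal Q.
Proof.
move=> /local_ideal_sub[a [s [aP ->]]]; rewrite localization_mapE.
apply/asboolP => I [[I0 II] QI].
have -> : frac (u a) (map_denominator s) =
    frac 1 (map_denominator s) * to_localization Q (u a) + 0.
  rewrite addr0 frac_mul; apply/fracP; exists (denominator1 Q).
  by rewrite !(denM, den1) !mul1r mulr1.
apply: II => //; apply: QI; exists (u a) => //=.
by rewrite mem_spectral_map.
Qed.

Definition residue_map (x : residue_field P) : residue_field Q :=
  \pi_(residue_field Q) (localization_map (repr x)).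

Lemma residue_mapE x :
  residue_map (\pi_(residue_field P) x) =
  \pi_(residue_field Q) (localization_map x).
Proof.
apply/residue_fieldP; rewrite -rmorphB; apply: localization_map_ideal.
by apply/residue_fieldP; rewrite reprK.
Qed.

Fact residue_map_zmod : zmod_morphism residue_map.
Proof.
elim/quotW=> x; elim/quotW=> y.
by rewrite -rmorphB !residue_mapE !rmorphB.
Qed.
Fact residue_map_monoid : monoid_morphism residue_map.
Proof.
split; first by rewrite -(rmorph1 \pi_(residue_field P)) residue_mapE !rmorph1.
elim/quotW=> x; elim/quotW=> y.
by rewrite -rmorphM !residue_mapE !rmorphM.
Qed.
HB.instance Definition _ :=
  GRing.isZmodMorphism.Build (residue_field P) (residue_field Q)
    residue_map residue_map_zmod.
HB.instance Definition _ :=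
  GRing.isMonoidMorphism.Build (residue_field P) (residue_field Q)
    residue_map residue_map_monoid.

Lemma residue_map_comm a :
  residue_map (to_residue_field P a) = to_residue_field Q (u a).
Proof.
rewrite residue_mapE localization_mapE; congr (\pi_(residue_field Q) _).
by apply/fracP; exists (denominator1 Q); rewrite !(den_map, den1) rmorph1.
Qed.

End ResidueMap.

(* The tensor product of A-algebras f : A -> C and g : A -> B.  A sequence
   of pairs stands for the sum of the corresponding pure tensors; opposites
   are available because (- c) (x) b is the opposite of c (x) b. *)
Section TensorProduct.
Variables (A C B : comPzRingType).
Variables (f : {rmorphism A -> C}) (g : {rmorphism A -> B}).

Inductive tensor_rel : seq (C * B) -> seq (C * B) -> Prop :=
| tensor_refl s : tensor_rel s s
| tensor_sym s t : tensor_rel s t -> tensor_rel t s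
| tensor_trans s t r : tensor_rel s t -> tensor_rel t r -> tensor_rel s r
| tensor_catC s t : tensor_rel (s ++ t) (t ++ s)
| tensor_cat s s' t : tensor_rel s s' -> tensor_rel (s ++ t) (s' ++ t)
| tensor_0l b : tensor_rel [:: (0, b)] [::]
| tensor_Dl c c' b : tensor_rel [:: (c + c', b)] [:: (c, b); (c', b)]
| tensor_Dr c b b' : tensor_rel [:: (c, b + b')] [:: (c, b); (c, b')]
| tensor_bal a c b : tensor_rel [:: (f a * c, b)] [:: (c, g a * b)].

Definition tensor_equiv (s t : seq (C * B)) : bool := `[< tensor_rel s t >].

Lemma tensor_equiv_is_equiv : equiv_class_of tensor_equiv.
Proof.
split=> [s|s t|t s r].
- exact/asboolP/tensor_refl.
- by apply/asboolP/asboolP; exact: tensor_sym.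
- by move=> /asboolP st /asboolP tr; apply/asboolP/(tensor_trans st tr).
Qed.

Canonical tensor_equiv_equiv := EquivRelPack tensor_equiv_is_equiv.
Canonical tensor_equiv_encModRel := defaultEncModRel tensor_equiv.

Definition tensor := {eq_quot tensor_equiv}.
HB.instance Definition _ : EqQuotient _ tensor_equiv tensor :=
  EqQuotient.on tensor.
HB.instance Definition _ := Choice.on tensor.

Definition tensor_sum (s : seq (C * B)) : tensor := \pi_tensor s.

Lemma tensor_sumP s t : tensor_sum s = tensor_sum t <-> tensor_rel s t.
Proof.
split=> [/eqP|e]; first by rewrite piE => /asboolP.
by apply/eqP; rewrite piE; apply/asboolP.
Qed.

Lemma tensor_ind (K : tensor -> Prop) :
  (forall s, K (tensor_sum s)) -> forall x, K x.
Proof. by move=> Ks; elim/quotW => s; exact: Ks. Qed.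

Lemma repr_tensor s : tensor_rel (repr (tensor_sum s)) s.
Proof. by apply/tensor_sumP; rewrite /tensor_sum reprK. Qed.

Lemma tensor_cat2 s s' t t' :
  tensor_rel s s' -> tensor_rel t t' -> tensor_rel (s ++ t) (s' ++ t').
Proof.
move=> ss' tt'; apply: tensor_trans (tensor_cat t ss') _.
apply: tensor_trans (tensor_catC _ _) _.
exact: tensor_trans (tensor_cat s' tt') (tensor_catC _ _).
Qed.

Definition tensor_add (x y : tensor) : tensor :=
  tensor_sum (repr x ++ repr y).
Definition tensor_opp (x : tensor) : tensor :=
  tensor_sum [seq (- p.1, p.2) | p <- repr x].
Definition tensor_mul (x y : tensor) : tensor :=
  tensor_sum [seq (p.1 * q.1, p.2 * q.2) | p <- repr x, q <- repr y].

Lemma tensor_addE s t :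
  tensor_add (tensor_sum s) (tensor_sum t) = tensor_sum (s ++ t).
Proof. by apply/tensor_sumP/tensor_cat2; exact: repr_tensor. Qed.

(* Multiplication by a fixed pair is compatible with the relation. *)
Lemma tensor_rel_scale c b s t : tensor_rel s t ->
  tensor_rel [seq (p.1 * c, p.2 * b) | p <- s] [seq (p.1 * c, p.2 * b) | p <- t].
Proof.
elim=> {s t} /=.
- by move=> s; exact: tensor_refl.
- by move=> s t _; exact: tensor_sym.
- by move=> s t r _ st _; exact: tensor_trans.
- by move=> s t; rewrite !map_cat; exact: tensor_catC.
- by move=> s s' t _ ss'; rewrite !map_cat; exact: tensor_cat.
- by move=> b'; rewrite mul0r; exact: tensor_0l.
- by move=> c1 c2 b'; rewrite mulrDl; exact: tensor_Dl.
- by move=> c1 b1 b2; rewrite mulrDl; exact: tensor_Dr.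
- by move=> a c1 b1; rewrite -!mulrA; exact: tensor_bal.
Qed.

Lemma tensor_oppE s :
  tensor_opp (tensor_sum s) = tensor_sum [seq (- p.1, p.2) | p <- s].
Proof.
apply/tensor_sumP; have := tensor_rel_scale (-1) 1 (repr_tensor s).
by under eq_map do rewrite mulrN1 mulr1;
   under [X in tensor_rel _ X]eq_map do rewrite mulrN1 mulr1.
Qed.

Fact tensor_addA : associative tensor_add.
Proof.
elim/tensor_ind=> s; elim/tensor_ind=> t; elim/tensor_ind=> r.
by rewrite !tensor_addE catA.
Qed.
Fact tensor_addC : commutative tensor_add.
Proof.
elim/tensor_ind=> s; elim/tensor_ind=> t.
by rewrite !tensor_addE; exact/tensor_sumP/tensor_catC.
Qed.
Fact tensor_add0 : left_id (tensor_sum [::]) tensor_add.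
Proof. by elim/tensor_ind=> s; rewrite tensor_addE. Qed.
Fact tensor_addN : left_inverse (tensor_sum [::]) tensor_opp tensor_add.
Proof.
elim/tensor_ind=> s; rewrite tensor_oppE tensor_addE.
have ACA x y z w : tensor_add (tensor_add x y) (tensor_add z w) =
    tensor_add (tensor_add x z) (tensor_add y w).
  rewrite -tensor_addA (tensor_addA y) (tensor_addC y).
  by rewrite -(tensor_addA z) tensor_addA.
elim: s => [|[c b] s IHs] //.
have -> : tensor_sum ([seq (- p.1, p.2) | p <- (c, b) :: s] ++ (c, b) :: s) =
  tensor_add (tensor_sum [:: (- c, b); (c, b)])
             (tensor_sum ([seq (- p.1, p.2) | p <- s] ++ s)).
  rewrite -(tensor_addE [seq _ | p <- s]) -(tensor_addE [:: _] [:: _]) ACA.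
  by rewrite !tensor_addE.
rewrite IHs tensor_addE; apply/tensor_sumP.
apply: tensor_trans (tensor_sym (tensor_Dl _ _ _)) _.
by rewrite addNr; exact: tensor_0l.
Qed.
HB.instance Definition _ := GRing.isZmodule.Build tensor
  tensor_addA tensor_addC tensor_add0 tensor_addN.

Definition pure_tensor (c : C) (b : B) : tensor := tensor_sum [:: (c, b)].

Lemma tensor_sumE s : tensor_sum s = \sum_(p <- s) pure_tensor p.1 p.2.
Proof.
elim: s => [|[c b] s IHs]; first by rewrite big_nil.
by rewrite big_cons -IHs; exact/esym/tensor_addE.
Qed.

Lemma pure_tensorDl c c' b :
  pure_tensor (c + c') b = pure_tensor c b + pure_tensor c' b.
Proof.
by rewrite [RHS]tensor_addE; apply/tensor_sumP; exact: tensor_Dl.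
Qed.
Lemma pure_tensorDr c b b' :
  pure_tensor c (b + b') = pure_tensor c b + pure_tensor c b'.
Proof.
by rewrite [RHS]tensor_addE; apply/tensor_sumP; exact: tensor_Dr.
Qed.
Lemma pure_tensor_bal a c b :
  pure_tensor (f a * c) b = pure_tensor c (g a * b).
Proof. by apply/tensor_sumP; exact: tensor_bal. Qed.

Let mulss (s t : seq (C * B)) := [seq (p.1 * q.1, p.2 * q.2) | p <- s, q <- t].

Lemma tensor_sum_mulss s t : tensor_sum (mulss s t) =
  \sum_(p <- s) \sum_(q <- t) pure_tensor (p.1 * q.1) (p.2 * q.2).
Proof. by rewrite tensor_sumE big_allpairs_dep. Qed.

Lemma tensor_rel_mulr s t t' :
  tensor_rel t t' -> tensor_sum (mulss s t) = tensor_sum (mulss s t').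
Proof.
move=> tt'; rewrite !tensor_sum_mulss; apply: eq_bigr => -[c b] _ /=.
have /tensor_sumP := tensor_rel_scale c b tt'.
rewrite !tensor_sumE !big_map /= => e.
by under eq_bigr do rewrite mulrC [b * _]mulrC;
   under [RHS]eq_bigr do rewrite mulrC [b * _]mulrC.
Qed.

Lemma mulssC s t : tensor_sum (mulss s t) = tensor_sum (mulss t s).
Proof.
rewrite !tensor_sum_mulss exchange_big; apply: eq_bigr => p _.
by apply: eq_bigr => q _; rewrite mulrC [p.2 * _]mulrC.
Qed.

Lemma tensor_mulE s t :
  tensor_mul (tensor_sum s) (tensor_sum t) = tensor_sum (mulss s t).
Proof.
rewrite /tensor_mul -/(mulss _ _) (tensor_rel_mulr _ (repr_tensor t)).
by rewrite mulssC (tensor_rel_mulr _ (repr_tensor s)) mulssC.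
Qed.

Fact tensor_mulA : associative tensor_mul.
Proof.
elim/tensor_ind=> s; elim/tensor_ind=> t; elim/tensor_ind=> r.
rewrite !tensor_mulE !tensor_sum_mulss !big_allpairs_dep /=.
apply: eq_bigr => p _; rewrite big_allpairs_dep /=.
apply: eq_bigr => q _; apply: eq_bigr => o _.
by rewrite !mulrA.
Qed.
Fact tensor_mulC : commutative tensor_mul.
Proof.
by elim/tensor_ind=> s; elim/tensor_ind=> t; rewrite !tensor_mulE mulssC.
Qed.
Fact tensor_mul1 : left_id (pure_tensor 1 1) tensor_mul.
Proof.
elim/tensor_ind=> s; rewrite tensor_mulE tensor_sum_mulss big_seq1 tensor_sumE.
by apply: eq_bigr => p _; rewrite !mul1r.
Qed.
Fact tensor_mulDl : left_distributive tensor_mul +%R.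
Proof.
elim/tensor_ind=> s; elim/tensor_ind=> t; elim/tensor_ind=> r.
rewrite [_ + _]tensor_addE !tensor_mulE !tensor_sum_mulss.
by rewrite big_cat.
Qed.
HB.instance Definition _ := GRing.Zmodule_isComPzRing.Build tensor
  tensor_mulA tensor_mulC tensor_mul1 tensor_mulDl.

Lemma pure_tensorM c b c' b' :
  pure_tensor c b * pure_tensor c' b' = pure_tensor (c * c') (b * b').
Proof. exact: tensor_mulE. Qed.

(* The ring morphism c (x) b |-> h c * k b. *)
Section Lift.
Variables (D : comPzRingType) (h : {rmorphism C -> D}) (k : {rmorphism B -> D}).
Hypothesis hk : forall a, h (f a) = k (g a).

(* The dependency on [hk] is what lets the morphism instances below be found. *)
Definition tensor_lift (x : tensor) : D :=
  let _ := hk in \sum_(p <- repr x) h p.1 * k p.2.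

Lemma tensor_liftE s :
  tensor_lift (tensor_sum s) = \sum_(p <- s) h p.1 * k p.2.
Proof.
rewrite /tensor_lift; move: (repr_tensor s); move: (repr _) => t.
elim=> {s t} //=.
- by move=> s t r _ -> _ ->.
- by move=> s t; rewrite !big_cat /= addrC.
- by move=> s s' t _ e; rewrite !big_cat /= e.
- by move=> b; rewrite big_seq1 big_nil rmorph0 mul0r.
- by move=> c c' b; rewrite !big_cons !big_nil rmorphD mulrDl !addr0.
- by move=> c b b'; rewrite !big_cons !big_nil rmorphD mulrDr !addr0.
- by move=> a c b; rewrite !big_seq1 !rmorphM hk mulrCA mulrA.
Qed.

Lemma tensor_lift_pure c b : tensor_lift (pure_tensor c b) = h c * k b.
Proof. by rewrite tensor_liftE big_seq1. Qed.

Fact tensor_lift_zmod : zmod_morphism tensor_lift.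
Proof.
elim/tensor_ind=> s; elim/tensor_ind=> t.
rewrite [- _]tensor_oppE [_ + _]tensor_addE !tensor_liftE big_cat; congr (_ + _).
by rewrite big_map -sumrN; apply: eq_bigr => p _; rewrite rmorphN mulNr.
Qed.
Fact tensor_lift_monoid : monoid_morphism tensor_lift.
Proof.
split; first by rewrite tensor_lift_pure !rmorph1 mulr1.
elim/tensor_ind=> s; elim/tensor_ind=> t.
rewrite [_ * _]tensor_mulE !tensor_liftE big_allpairs_dep big_distrlr /=.
apply: eq_bigr => p _; apply: eq_bigr => q _.
by rewrite !rmorphM mulrACA.
Qed.
HB.instance Definition _ :=
  GRing.isZmodMorphism.Build tensor D tensor_lift tensor_lift_zmod.
HB.instance Definition _ :=
  GRing.isMonoidMorphism.Build tensor D tensor_lift tensor_lift_monoid.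
End Lift.
End TensorProduct.

Arguments pure_tensor {A C B} f g c b.
Arguments tensor_lift {A C B f g D h k} hk x.

Section Fibre.
Variables (A B : comNzRingType) (u : {rmorphism A -> B}).
Variables (P : prime_idealr A) (Q : prime_idealr B).
Hypothesis uQP : spectral_map u Q = P.

(* The canonical map k_A(P) (x)_A B -> k_B(Q). *)
Definition fibre_map :
    {rmorphism tensor (to_residue_field P) u -> residue_field Q} :=
  tensor_lift (f := to_residue_field P) (g := u)
    (h := residue_map uQP) (k := to_residue_field Q) (residue_map_comm uQP).

Lemma fibre_mapE a s b :
  fibre_map (pure_tensor _ _ (\pi_(residue_field P) (frac a s)) b) =
  \pi_(residue_field Q) (frac (u a * b) (map_denominator uQP s)).
Proof.
rewrite [LHS]tensor_lift_pure /= residue_mapE localization_mapE -rmorphM.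
congr (\pi_(residue_field Q) _); rewrite frac_mul.
by apply/fracP; exists (denominator1 Q); rewrite !(denM, den1) !mulr1.
Qed.
End Fibre.

(* Main.v *)
From HB Require Import structures.
From mathcomp Require Import all_boot all_algebra.
From mathcomp Require Import ring boolp classical_sets.
Require Import Defs.

(** Fix a prime P of A.  The A-prime ideals of B contracting to P are the
    contractions of the proper ideals of the fibre ring F = k_A(P) (x)_A B:
    they contain PB, and elements of A outside P act injectively modulo them.
    So for a PSI-morphism every proper ideal of F is prime.  A nonzero ring
    with this property is a field: if the ideal of z^2 is proper, then it
    contains z, so z (1 - c z) = 0 for some c, and (0) is prime.  Hence F is
    zero or a field, that is, the fibre of Spec over P has at most one point Q,
    and F = k_B(Q) if it has one.

    The proof runs this argument in B.  [fibre_ideal P x] is the contraction to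
    B of the ideal of F generated by the image of x; it is A-prime as soon as
    it is proper ([fibre_ideal_A_prime]).  Taking x = 0 and x = b^2 with b in Q
    identifies Q with [fibre_ideal P 0], the saturation of PB ([mem_over]);
    this gives (i) and the description of Q in (ii).  Taking x = t outside Q
    shows that t is invertible in F ([fibre_ideal_notin]).

    As for the canonical map F -> k_B(Q), every element of F is a pure tensor
    (1/s) (x) b ([fibre_frac_surj]), sent to b/u(s).  If this vanishes, then b
    is in Q, so u(t) b lies in PB for some t outside P and the tensor is zero.
    The map is onto because elements outside Q are invertible in F.

    For (iii), every proper ideal of B containing MB is A-prime, because u(a)
    is invertible modulo MB when a is outside M.  All of them are therefore
    primes over M, hence equal by (i).  Part (iv) is the case M = 0. *)

Set Implicit Arguments.
Unset Strict Implicit.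
Unset Printing Implicit Defensive.

Import GRing.Theory.
Local Open Scope ring_scope.
Local Open Scope quotient_scope.
Local Open Scope classical_set_scope.

(** * Points of the spectrum *)

Section BundledPrime.
Variables (R : comNzRingType) (I : {pred R}).

(** The proof argument makes the instances below depend on it, so that they
    can be attached to an arbitrary predicate. *)
Definition spec_point_pred (_ : prime_ideal I) : {pred R} := I.
Variable I_prime : prime_ideal I.
HB.instance Definition _ :=
  isIdealr.Build R (spec_point_pred I_prime) I_prime.1.
HB.instance Definition _ :=
  isPrimeIdealrClosed.Build R (spec_point_pred I_prime) I_prime.2.

Definition spec_point : prime_idealr R := spec_point_pred I_prime.

Lemma mem_spec_point x : (x \in spec_point) = (x \in I).
Proof. by []. Qed.

End BundledPrime.
Arguments spec_point {R I} I_prime.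

(** * Extended ideals and the ideals of a fibre *)

Section ExtendedIdeal.
Variables (A B : comNzRingType) (u : {rmorphism A -> B}).
Implicit Types (I : {pred A}) (P : prime_idealr A) (Q : prime_idealr B).

Lemma extended_ideal_is_ideal I : is_ideal [set` extended_ideal u I].
Proof.
split=> [|c x y /asboolP xI /asboolP yI]; apply/asboolP => J [[J0 JD] IJ] //.
by apply: (JD); [exact: (xI J) | exact: (yI J)].
Qed.

Lemma extended_ideal0 I : 0 \in extended_ideal u I.
Proof. exact: (extended_ideal_is_ideal I).1. Qed.

Lemma extended_idealMl I c x :
  x \in extended_ideal u I -> c * x \in extended_ideal u I.
Proof.
move=> xI; rewrite -[c * x]addr0.
exact: (extended_ideal_is_ideal I).2 xI (extended_ideal0 I).
Qed.

Lemma extended_idealD I x y : x \in extended_ideal u I ->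
  y \in extended_ideal u I -> x + y \in extended_ideal u I.
Proof.
move=> xI yI; rewrite -[x]mul1r; exact: (extended_ideal_is_ideal I).2 xI yI.
Qed.

Lemma mem_extended_ideal I a : a \in I -> u a \in extended_ideal u I.
Proof. by move=> aI; apply/asboolP => J [_]; apply; exists a. Qed.

Lemma extended_ideal_min {I} {J : set B} : is_ideal J ->
  (forall a, a \in I -> J (u a)) -> forall b, b \in extended_ideal u I -> J b.
Proof.
by move=> J_ideal IJ b /asboolP; apply=> //; split=> // _ [a aI <-]; apply: IJ.
Qed.

Lemma idealr_is_ideal {R : comNzRingType} {I : {pred R}} :
  idealr_closed I -> is_ideal [set` I].
Proof. by case=> I0 _ ID; split=> // a x y; apply: ID. Qed.

Section Fibre.
Variable P : prime_idealr A.

(** The inverse image in B of the principal ideal generated by 1 (x) x in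
    k_A(P) (x)_A B. *)
Definition fibre_ideal (x : B) : {pred B} := fun b =>
  `[< exists s c, s \notin P /\ u s * b - c * x \in extended_ideal u P >].

Lemma fibre_idealP x b :
  reflect (exists s c, s \notin P /\ u s * b - c * x \in extended_ideal u P)
          (b \in fibre_ideal x).
Proof. exact: asboolP. Qed.

Lemma fibre_ideal0P b :
  (exists2 s, s \notin P & u s * b \in extended_ideal u P) <->
  b \in fibre_ideal 0.
Proof.
split=> [[s sP sb]|/fibre_idealP[s [c [sP]]]].
  by apply/fibre_idealP; exists s, 0; rewrite mulr0 subr0.
by rewrite mulr0 subr0; exists s.
Qed.

Lemma mem_fibre_ideal x : x \in fibre_ideal x.
Proof.
apply/fibre_idealP; exists 1, 1.
by rewrite idealr1 rmorph1 subrr extended_ideal0.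
Qed.

Lemma extended_sub_fibre x b : b \in extended_ideal u P -> b \in fibre_ideal x.
Proof.
move=> bP; apply/fibre_idealP; exists 1, 0.
by rewrite idealr1 rmorph1 mul1r mul0r subr0.
Qed.

Lemma fibre_ideal_unit x s b :
  s \notin P -> u s * b \in fibre_ideal x -> b \in fibre_ideal x.
Proof.
move=> sP /fibre_idealP[t [c [tP tb]]]; apply/fibre_idealP.
by exists (t * s), c; rewrite prime_idealrM negb_or tP sP rmorphM -mulrA.
Qed.

(** Elements of P land in PB, and the elements outside P can be cancelled since
    they are absorbed into the denominator s. *)
Lemma fibre_ideal_A_prime x :
  1 \notin fibre_ideal x -> A_prime_ideal u (fibre_ideal x).
Proof.
move=> proper; split; last first.
  move=> a b; case: (boolP (a \in P)) => aP.
    by move=> _; left; apply/extended_sub_fibre/mem_extended_ideal.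
  by move/(fibre_ideal_unit aP); right.
split=> //; first by apply: extended_sub_fibre; exact: extended_ideal0.
move=> d b1 b2 /fibre_idealP[s [c [sP sb]]] /fibre_idealP[t [e [tP tb]]].
apply/fibre_idealP; exists (s * t), (d * u t * c + u s * e); split.
  by rewrite prime_idealrM negb_or sP tP.
have -> : u (s * t) * (d * b1 + b2) - (d * u t * c + u s * e) * x =
    d * u t * (u s * b1 - c * x) + u s * (u t * b2 - e * x).
  by rewrite rmorphM; ring.
by apply: extended_idealD; apply: extended_idealMl.
Qed.

Lemma spectral_map_over Q : (forall a, (u a \in Q) = (a \in P)) ->
  spectral_map u Q = P.
Proof. by move=> QP; apply: prime_idealr_eq => a; exact: QP. Qed.

Lemma extended_sub_over Q b :
  spectral_map u Q = P -> b \in extended_ideal u P -> b \in Q.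
Proof.
move=> uQP; apply: (extended_ideal_min (J := [set` Q])).
  split=> [|c x y /= xQ yQ]; first exact: rpred0.
  by rewrite rpredD // idealMr.
by move=> a aP; rewrite /= (mem_spectral_map uQP).
Qed.

(** Q contains PB and is disjoint from the image of A - P, so it is saturated;
    in particular [fibre_ideal P x] is proper for x in Q. *)
Lemma fibre_sub_over Q x b : spectral_map u Q = P -> x \in Q ->
  b \in fibre_ideal x -> b \in Q.
Proof.
move=> uQP xQ /fibre_idealP[s [c [sP /(extended_sub_over uQP)]]].
rewrite rpredBr; last exact: idealMr.
by rewrite prime_idealrM (mem_spectral_map uQP) (negPf sP).
Qed.

End Fibre.

(** * Uniqueness of the prime over a given prime *)

Hypothesis u_PSI : PSI_morphism u.

Lemma fibre_ideal_prime P x :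
  1 \notin fibre_ideal P x -> prime_ideal (fibre_ideal P x).
Proof. by move=> /fibre_ideal_A_prime; exact: u_PSI. Qed.

(** For b in Q the ideal attached to b^2 is prime, so it contains b: modulo PB,
    u(s) b = c b^2 for some s outside P.  Then b (u(s) - c b) lies in the prime
    ideal attached to 0, while u(s) - c b is not in Q; so b is in that ideal. *)
Lemma mem_over P Q b : spectral_map u Q = P ->
  (b \in Q) = (b \in fibre_ideal P 0).
Proof.
move=> uQP; apply/idP/idP; last exact: fibre_sub_over uQP (rpred0 Q).
have prime_fibre x : x \in Q -> prime_ideal (fibre_ideal P x).
  move=> xQ; apply: fibre_ideal_prime; apply/negP.
  by move=> /(fibre_sub_over uQP xQ); rewrite idealr1.
move=> bQ; have [_ Pbb] := prime_fibre (b * b) (idealMr b bQ).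
have /Pbb : b * b \in fibre_ideal P (b * b) by exact: mem_fibre_ideal.
rewrite orbb => /fibre_idealP[s [c [sP sb]]].
have [_ P0] := prime_fibre 0 (rpred0 Q).
have /P0/orP[//|] : b * (u s - c * b) \in fibre_ideal P 0.
  apply: extended_sub_fibre.
  have -> : b * (u s - c * b) = u s * b - c * (b * b) by ring.
  exact: sb.
move=> /(fibre_sub_over uQP (rpred0 Q)).
rewrite rpredBr; last exact: idealMr.
by rewrite (mem_spectral_map uQP) (negPf sP).
Qed.

Lemma spectral_map_inj : injective (spectral_map u).
Proof.
move=> Q Q' e; apply: prime_idealr_eq => b.
by rewrite (mem_over _ (erefl (spectral_map u Q'))) (mem_over _ e).
Qed.

(** The image of t in the fibre ring is a unit.  Otherwise the ideal attached
    to t would be a prime over P, so would be Q, although t is not in Q. *)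
Lemma fibre_ideal_notin P Q t : spectral_map u Q = P -> t \notin Q ->
  1 \in fibre_ideal P t.
Proof.
move=> uQP tQ; apply: contraNT tQ => proper.
pose T := spec_point (fibre_ideal_prime proper).
suff uTP : spectral_map u T = P.
  have -> : Q = T by apply: spectral_map_inj; rewrite uQP uTP.
  by rewrite mem_spec_point mem_fibre_ideal.
apply: spectral_map_over => a; rewrite mem_spec_point; apply/idP/idP.
  apply: contraLR => aP; apply: contra (proper) => aT.
  by apply: (fibre_ideal_unit aP); rewrite mulr1.
by move=> aP; apply/extended_sub_fibre/mem_extended_ideal.
Qed.

End ExtendedIdeal.

(** * The canonical map from the fibre ring to the residue field *)

Lemma residue_frac_eq0 (R : comNzRingType) (P : prime_idealr R) a
    (s : denominator P) :
  \pi_(residue_field P) (frac a s) = 0 <-> a \in P.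
Proof.
rewrite -(rmorph0 \pi_(residue_field P)) -residue_fieldP subr0.
split=> [/local_ideal_sub[b [t [bP /fracP[v e]]]]|aP].
  have : den v * (a * den t) \in P by rewrite e mulrCA mulrC idealMr // idealMr.
  by rewrite !prime_idealrM !(negPf (denP _)) /= orbF.
have -> : frac a s = frac 1 s * to_localization P a.
  by rewrite frac_mul; apply/fracP; exists s; rewrite denM den1 mul1r mulr1.
exact/extended_idealMl/mem_extended_ideal.
Qed.

Section FibreMap.
Variables (A B : comNzRingType) (u : {rmorphism A -> B}).
Variable P : prime_idealr A.
Implicit Types (s t : denominator P) (b c : B).

Definition fibre_frac s b : tensor (to_residue_field P) u :=
  pure_tensor _ _ (\pi_(residue_field P) (frac 1 s)) b.

Lemma pure_tensor_frac a s b :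
  pure_tensor (to_residue_field P) u (\pi_(residue_field P) (frac a s)) b =
  fibre_frac s (u a * b).
Proof.
have -> : frac a s = to_localization P a * frac 1 s.
  by rewrite frac_mul; apply/fracP; exists s; rewrite denM den1 mul1r mulr1.
by rewrite rmorphM /fibre_frac -pure_tensor_bal.
Qed.

Lemma fibre_fracD s b c :
  fibre_frac s (b + c) = fibre_frac s b + fibre_frac s c.
Proof. exact: pure_tensorDr. Qed.

Lemma fibre_fracMl s b c :
  fibre_frac s (b * c) = pure_tensor _ _ 1 b * fibre_frac s c.
Proof. by rewrite pure_tensorM mul1r. Qed.

Lemma fibre_frac0 s : fibre_frac s 0 = 0.
Proof. by apply: (addrI (fibre_frac s 0)); rewrite -fibre_fracD !addr0. Qed.

Lemma fibre_frac_expand s t b :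
  fibre_frac s b = fibre_frac (denominatorM s t) (u (den t) * b).
Proof.
rewrite -pure_tensor_frac; congr (pure_tensor _ _ (\pi_(residue_field P) _) _).
by apply/fracP; exists s; rewrite denM mul1r [den t * _]mulrC.
Qed.

(** Numerators move across the tensor product, and two tensors (1/s) (x) b and
    (1/t) (x) d are added over the common denominator s t. *)
Lemma fibre_frac_surj (x : tensor (to_residue_field P) u) :
  exists s b, x = fibre_frac s b.
Proof.
elim/tensor_ind: x => l; rewrite tensor_sumE.
elim: l => [|[c b] l [t [d IHl]]].
  by exists (denominator1 P), 0; rewrite big_nil fibre_frac0.
rewrite big_cons IHl /=; elim/quotW: c => x; elim/frac_ind: x => a s.
rewrite pure_tensor_frac; exists (denominatorM s t).
rewrite (fibre_frac_expand s t) (fibre_frac_expand t s).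
have -> : denominatorM t s = denominatorM s t by apply: val_inj; exact: mulrC.
by rewrite -fibre_fracD; eexists.
Qed.

Lemma fibre_frac_extended0 s b : b \in extended_ideal u P -> fibre_frac s b = 0.
Proof.
apply: (extended_ideal_min (J := [set b | fibre_frac s b = 0])).
  split=> [|c x y /= x0 y0]; first exact: fibre_frac0.
  by rewrite fibre_fracD fibre_fracMl x0 y0 mulr0 addr0.
move=> a /(residue_frac_eq0 _ s) a0 /=.
rewrite -[u a]mulr1 -pure_tensor_frac a0.
by apply/tensor_sumP; exact: tensor_0l.
Qed.

Variable Q : prime_idealr B.
Hypothesis u_PSI : PSI_morphism u.
Hypothesis uQP : spectral_map u Q = P.

Lemma fibre_map_frac s b : fibre_map uQP (fibre_frac s b) =
  \pi_(residue_field Q) (frac b (map_denominator uQP s)).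
Proof. by rewrite fibre_mapE rmorph1 mul1r. Qed.

(** A pure tensor (1/s) (x) b with image zero has b in Q, so u(t) b lies in PB
    for some t outside P, and (1/s) (x) b = (1/(s t)) (x) u(t) b = 0. *)
Lemma fibre_map_inj : injective (fibre_map uQP).
Proof.
apply: raddf_inj => x; have [s [b ->]] := fibre_frac_surj x.
move=> /(etrans (esym (fibre_map_frac s b)))/residue_frac_eq0.
rewrite (mem_over u_PSI _ uQP) => /fibre_ideal0P[t tP tb].
rewrite (fibre_frac_expand s (Sub t tP)); exact: fibre_frac_extended0.
Qed.

(** To reach b/t, write u(s) = c t modulo PB, which is possible because t is
    invertible in the fibre ring; then b/t = b c / u(s). *)
Lemma fibre_map_surj y : exists x, fibre_map uQP x = y.
Proof.
elim/quotW: y => x; elim/frac_ind: x => b t.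
have /fibre_idealP[s [c [sP]]] := fibre_ideal_notin u_PSI uQP (denP t).
rewrite mulr1 => /(extended_sub_over uQP) stQ.
exists (fibre_frac (Sub s sP) (b * c)); rewrite fibre_map_frac.
apply/eqP; rewrite -subr_eq0 -rmorphB; apply/eqP.
rewrite frac_opp frac_add; apply/residue_frac_eq0.
rewrite den_map /= mulNr -mulrA -mulrBr idealMr // -opprB rpredN.
by rewrite [c * _]mulrC in stQ *.
Qed.

Lemma fibre_map_bij : bijective (fibre_map uQP).
Proof.
have [g gK] := choice fibre_map_surj.
by exists g => // x; apply: fibre_map_inj; rewrite gK.
Qed.

End FibreMap.

(** * Maximal ideals and fields *)

Lemma maximal_ideal_inv (R : comNzRingType) (M : {pred R}) x :
  maximal_ideal M -> x \notin M -> exists c, 1 - c * x \in M.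
Proof.
move=> [[M0 M1 MD] Mmax] xM; apply: contrapT => noinv.
pose J : {pred R} := fun y => `[< exists c, y - c * x \in M >].
have JP y : reflect (exists c, y - c * x \in M) (y \in J) by exact: asboolP.
suff J_ideal : idealr_closed J.
  case/negP: xM; rewrite -(Mmax J) //; last first.
    by move=> y yM; apply/JP; exists 0; rewrite mul0r subr0.
  by apply/JP; exists 1; rewrite mul1r subrr.
split; first by apply/JP; exists 0; rewrite mul0r subr0.
  by apply/JP.
move=> d y z /JP[c yM] /JP[e zM]; apply/JP; exists (d * c + e).
have -> : d * y + z - (d * c + e) * x = d * (y - c * x) + (z - e * x) by ring.
exact: MD.
Qed.

Lemma maximal_ideal_prime (R : comNzRingType) (M : {pred R}) :
  maximal_ideal M -> prime_ideal M.
Proof.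
move=> M_max; have [[M0 M1 MD] _] := M_max; split=> // x y xyM.
case: (boolP (x \in M)) => //= /(maximal_ideal_inv M_max)[c cM].
have -> : y = y * (1 - c * x) + (c * (x * y) + 0) by ring.
by apply: (MD) => //; apply: (MD).
Qed.

Section MaximalIdeal.
Variables (A B : comNzRingType) (u : {rmorphism A -> B}).
Hypothesis u_PSI : PSI_morphism u.
Variable M : {pred A}.
Hypothesis M_max : maximal_ideal M.

Section Over.
Variable J : {pred B}.
Hypotheses (J_ideal : idealr_closed J).
Hypothesis MJ : {subset extended_ideal u M <= J}.

Lemma over_maximal_ideal_unit a b : a \notin M -> u a * b \in J -> b \in J.
Proof.
have [J0 J1 JD] := J_ideal.
move=> /(maximal_ideal_inv M_max)[c cM] abJ.
have -> : b = b * u (1 - c * a) + (u c * (u a * b) + 0).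
  by rewrite rmorphB rmorphM rmorph1; ring.
by apply: (JD); [exact/MJ/mem_extended_ideal | exact: JD].
Qed.

(** J is A-prime: elements of M land in MB, and those outside M are invertible
    modulo M, so they can be cancelled. *)
Lemma over_maximal_ideal_prime : prime_ideal J.
Proof.
apply: u_PSI; split=> // a b; case: (boolP (a \in M)) => [aM _|aM].
  by left; exact/MJ/mem_extended_ideal.
by move/(over_maximal_ideal_unit aM); right.
Qed.

Lemma spectral_map_over_maximal :
  spectral_map u (spec_point over_maximal_ideal_prime) =
  spec_point (maximal_ideal_prime M_max).
Proof.
apply: spectral_map_over => a; rewrite !mem_spec_point; apply/idP/idP.
  have [_ J1 _] := J_ideal; apply: contraLR => aM; apply: contra J1 => aJ.
  by apply: (over_maximal_ideal_unit aM); rewrite mulr1.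
by move=> aM; exact/MJ/mem_extended_ideal.
Qed.

End Over.

(** MB and any proper ideal J containing it are both primes lying over M, so
    they coincide by injectivity of the spectral map. *)
Lemma extended_maximal_ideal :
  maximal_ideal (extended_ideal u M) \/ extended_ideal u M =i predT.
Proof.
have [MB1|MB1] := boolP (1 \in extended_ideal u M); [right|left].
  by move=> b; rewrite -[b]mulr1 extended_idealMl.
have MB_ideal : idealr_closed (extended_ideal u M).
  by have [MB0 MBD] := extended_ideal_is_ideal u M; split.
split=> // J J_ideal MJ b.
have e : spec_point (over_maximal_ideal_prime J_ideal MJ) =
         spec_point (over_maximal_ideal_prime MB_ideal (fun=> id)).
  by apply: (spectral_map_inj u_PSI); rewrite !spectral_map_over_maximal.
by rewrite -(mem_spec_point (over_maximal_ideal_prime J_ideal MJ)) e.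
Qed.

End MaximalIdeal.

Lemma zero_ideal_closed (R : comNzRingType) : idealr_closed (pred1 (0 : R)).
Proof.
split; rewrite ?inE ?oner_eq0 // => c x y /eqP-> /eqP->.
by rewrite inE mulr0 addr0.
Qed.

Lemma field_zero_ideal_maximal (R : comNzRingType) :
  field_ring R <-> maximal_ideal (pred1 (0 : R)).
Proof.
split=> [R_field|R_max x x0]; last first.
  have [c] := maximal_ideal_inv R_max x0.
  by rewrite inE subr_eq0 mulrC => /eqP; exists c.
split=> [|J [J0 J1 JD] _ x]; first exact: zero_ideal_closed.
rewrite inE; apply/idP/eqP => [xJ|-> //].
apply: contraNeq J1 => /R_field[y xy].
by rewrite -xy mulrC -[_ * _]addr0; exact: JD.
Qed.

Lemma extended_zero_ideal (A B : comNzRingType) (u : {rmorphism A -> B}) :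
  extended_ideal u (pred1 0) =i pred1 0.
Proof.
move=> b; apply/idP/idP => [|/eqP->]; last exact: extended_ideal0.
apply: (extended_ideal_min (idealr_is_ideal (@zero_ideal_closed B))).
by move=> a /eqP->; rewrite rmorph0 /= inE.
Qed.

Lemma PSI_field (A B : comNzRingType) (u : {rmorphism A -> B}) :
  PSI_morphism u -> field_ring A -> field_ring B.
Proof.
move=> u_PSI /field_zero_ideal_maximal/(extended_maximal_ideal u_PSI).
have e : extended_ideal u (pred1 0) = pred1 0.
  by apply/funext => b; exact: extended_zero_ideal.
rewrite e => -[/field_zero_ideal_maximal //|/(_ 1)].
by rewrite !inE oner_eq0.
Qed.

Unset Implicit Arguments.

Theorem corollary2p5 (A B : comNzRingType) (u : {rmorphism A -> B})
    (u_PSI : PSI_morphism u) :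
  [/\ injective (spectral_map u),
      forall P : prime_idealr A,
        (exists Q : prime_idealr B, spectral_map u Q = P) ->
        exists (Q : prime_idealr B) (uQP : spectral_map u Q = P),
          [/\ forall Q' : prime_idealr B, spectral_map u Q' = P <-> Q' = Q,
              [set` Q] = [set b | exists2 s : A,
                            s \notin P & u s * b \in extended_ideal u P]
            & bijective (fibre_map uQP)],
      forall M : {pred A}, maximal_ideal M ->
        maximal_ideal (extended_ideal u M) \/ extended_ideal u M =i predT
    & field_ring A -> field_ring B].
Proof.
split; [exact: spectral_map_inj | | | exact: (PSI_field u_PSI)].
  move=> P [Q uQP]; exists Q, uQP; split; last exact: fibre_map_bij.
    move=> Q'; split=> [uQ'P|-> //].
    by apply: (spectral_map_inj u_PSI); rewrite uQ'P uQP.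
  apply/seteqP; split=> b /=.
    by rewrite (mem_over u_PSI _ uQP) => /fibre_ideal0P.
  by move=> /fibre_ideal0P; rewrite -(mem_over u_PSI _ uQP).
by move=> M; exact: extended_maximal_ideal.
Qed.
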